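(* Let $p$ be an odd prime and $m\ge1$ an integer. The characteristic functions $f_{\mathcal B_0}(\mathbf X)$ and $f_{\mathcal B_1}(\mathbf X)$ are roots of a quadratic equation $$y^2-\sigma_1y+\sigma_2=0 \bmod \mathfrak I_{\mathbf X}$$ in the residue ring of multivariate polynomials $\mathbb Z[\mathbf X]/\mathfrak I_{\mathbf X}$, where the sum $\sigma_1=f_{\mathcal B_0}(\mathbf X)+f_{\mathcal B_1}(\mathbf X)$ and the product $\sigma_2=f_{\mathcal B_0}(\mathbf X)f_{\mathcal B_1}(\mathbf X)$ of the roots are $$\sigma_1=-1+\Phi(\mathbf X)\bmod \mathfrak I_{\mathbf X},$$ $$\sigma_2=-\frac14\left[p^m\chi_2(-1)-1-\Phi(\mathbf X)\left(p^m-2+\chi_2(-1)\right)\right]\bmod \mathfrak I_{\mathbf X}.$$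
   Context: $\mathbb F_{p^m}$ is the finite field with $p^m$ elements, with basis $\{1,\eta,\dots,\eta^{m-1}\}$ over $\mathbb F_p$, where $\eta$ is a root of an irreducible polynomial of degree $m$ over $\mathbb F_p$. $\mathcal B_0$ is the set of nonzero squares in $\mathbb F_{p^m}$ and $\mathcal B_1=\mathbb F_{p^m}^*\setminus\mathcal B_0$. $\chi_2$ is the quadratic character: $\chi_2=1$ on $\mathcal B_0$, $\chi_2=-1$ on $\mathcal B_1$, $\chi_2(0)=0$. $\mathbf X=(x_0,\dots,x_{m-1})$ are indeterminates. For $\gamma=\gamma_0+\gamma_1\eta+\cdots+\gamma_{m-1}\eta^{m-1}\in\mathbb F_{p^m}$ with $\gamma_k\in\mathbb F_p$ identified with its representative in $\{0,\dots,p-1\}$, $\mathbf X^\gamma$ denotes the monomial $x_0^{\gamma_0}x_1^{\gamma_1}\cdots x_{m-1}^{\gamma_{m-1}}$. The characteristic function of $\mathcal B_j$ is $f_{\mathcal B_j}(\mathbf X)=\sum_{\gamma\in\mathcal B_j}\mathbf X^\gamma$, $j=0,1$. $\mathfrak I_{\mathbf X}$ is the ideal generated by $x_0^p-1,\dots,x_{m-1}^p-1$. $\Phi(\mathbf X)=\prod_{k=0}^{m-1}\Phi_p(x_k)$, where $\Phi_p(x)=1+x+\cdots+x^{p-1}$ is the $p$-th cyclotomic polynomial. *)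

(* Defs.v *)
From HB Require Import structures.
From mathcomp Require Import all_boot all_order all_algebra all_field.
From mathcomp Require Import ring_quotient.
From mathcomp Require Import mpoly.
From mathcomp Require boolp.

Set Implicit Arguments.
Unset Strict Implicit.
Unset Printing Implicit Defensive.

Import GRing.Theory.
Local Open Scope ring_scope.
Local Open Scope quotient_scope.

(* The ideal of Z[x_0, ..., x_{m-1}] generated by the x_k^p - 1; it is proper
   for all p and m. *)
Section ResidueRing.

Variables p m : nat.

Definition in_ideal_X (f : {mpoly int[m]}) : Prop :=
  exists q : 'I_m -> {mpoly int[m]}, f = \sum_(k < m) q k * ('X_k ^+ p - 1).

Definition ideal_X : pred {mpoly int[m]} := fun f => boolp.asbool (in_ideal_X f).

Lemma ideal_X_idealr_closed : idealr_closed ideal_X.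
Proof.
split=> [||a u v].
- apply/boolp.asboolP; exists (fun=> 0).
  by rewrite big1 // => k _; rewrite mul0r.
- apply/negP => /boolp.asboolP [q /(congr1 (meval (fun=> 1)))].
  rewrite rmorph1 rmorph_sum big1 => [/eqP|k _]; first by rewrite oner_eq0.
  by rewrite /= rmorphM rmorphB rmorphXn rmorph1 /= mevalXU expr1n subrr mulr0.
move=> /boolp.asboolP [q ->] /boolp.asboolP [r ->].
apply/boolp.asboolP; exists (fun k => a * q k + r k).
rewrite mulr_sumr -big_split /=; apply: eq_bigr => k _.
by rewrite mulrDl mulrA.
Qed.

HB.instance Definition _ := isIdealr.Build _ ideal_X ideal_X_idealr_closed.

Definition ideal_X_idealr : idealr {mpoly int[m]} := ideal_X.

Definition residue_ring := {ideal_quot ideal_X_idealr}.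

HB.instance Definition _ := GRing.ComNzRing.on residue_ring.

Definition residue (f : {mpoly int[m]}) : residue_ring := \pi_{ideal_quot ideal_X_idealr} f.

Definition Phi_X : {mpoly int[m]} := \prod_(k < m) \sum_(i < p) 'X_k ^+ i.

End ResidueRing.

Section QuadraticCharacter.

Variable F : finFieldType.

Definition nz_squares : {set F} := [set x | x != 0 & [exists y, x == y ^+ 2]].

Definition nonsquares : {set F} := [set x | x != 0] :\: nz_squares.

Definition quad_char (x : F) : int :=
  if x \in nz_squares then 1 else if x \in nonsquares then -1 else 0.

End QuadraticCharacter.

Section CharacteristicFunctions.

Variables (p m : nat) (L : fieldExtType 'F_p) (eta : L).

(* [coord] returns the coordinates in the family 1, eta, ..., eta^(m-1), which
   is a basis when eta has degree m = [L : F_p]; [nat_of_ord] gives the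
   representative of an element of F_p in {0, ..., p-1}. *)
Definition monomial_of (g : L) : 'X_{1..m} :=
  [multinom nat_of_ord (coord [tuple eta ^+ i | i < m] k g) | k < m].

Definition char_fun (B : {set finvect_type L}) : {mpoly int[m]} :=
  \sum_(g in B) 'X_[monomial_of g].

End CharacteristicFunctions.

(* Main.v *)
(** The map sending g to the class of X^g is an additive character from L to the
    residue ring, and the sum of its values over L is Phi(X). Writing N(g) for
    the number of ways to express g as a square of B_0 plus a nonsquare of B_1,
    the product of the roots is the sum of the N(g) X^g. Multiplication by a
    nonzero c either preserves B_0 and B_1 or exchanges them, so N is constant
    on L^*; this constant comes from counting all the pairs in B_0 x B_1. *)

From HB Require Import structures.
Require Import Defs.
From mathcomp Require Import all_boot all_order all_algebra all_field.
From mathcomp Require Import ring_quotient.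
From mathcomp Require Import mpoly.
From mathcomp Require Import ring zify.

Set Implicit Arguments.
Unset Strict Implicit.
Unset Printing Implicit Defensive.

Import GRing.Theory.
Local Open Scope ring_scope.

(** * Counting representations as a square plus a nonsquare *)

Section SquareCounting.

Variable F : finFieldType.
Hypothesis two_neq0 : 2%:R != 0 :> F.

Let B0 := nz_squares F.
Let B1 := nonsquares F.

Lemma nz_squaresP (x : F) :
  reflect (exists2 y, y != 0 & x = y ^+ 2) (x \in nz_squares F).
Proof.
rewrite inE; apply: (iffP andP) => [[x0 /existsP[y /eqP xE]]|[y y0 ->]].
  by exists y => //; apply: contraNneq x0 => y0; rewrite xE y0 expr0n.
by rewrite expf_neq0 //; split=> //; apply/existsP; exists y.
Qed.

Lemma in_nonsquares (x : F) :
  (x \in nonsquares F) = (x != 0) && (x \notin nz_squares F).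
Proof. by rewrite inE andbC inE. Qed.

Lemma nz_squares_neq0 (x : F) : x \in nz_squares F -> x != 0.
Proof. by rewrite inE => /andP[]. Qed.

Lemma nonsquares_neq0 (x : F) : x \in nonsquares F -> x != 0.
Proof. by rewrite in_nonsquares => /andP[]. Qed.

Lemma card_neq0 : #|[set x : F | x != 0]| = (#|B0| + #|B1|)%N.
Proof.
rewrite /B1 /nonsquares -(cardsID B0); congr (_ + _)%N.
by apply: eq_card => x; rewrite !inE; case: eqP.
Qed.

(** Squaring is two-to-one on nonzero elements: the fibre over [y ^+ 2] is [[set y; - y]], and
    [y != - y] because 2 is invertible. *)
Lemma card_neq0_double : #|[set x : F | x != 0]| = (#|B0| * 2)%N.
Proof.
rewrite -sum1_card (partition_big (fun x => x ^+ 2) (fun b => b \in B0)) /=;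
  last first.
  by move=> x; rewrite inE => x0; apply/nz_squaresP; exists x.
rewrite -sum_nat_const; apply: eq_bigr => b /nz_squaresP[y y0 ->].
have yNy : y != - y by rewrite -addr_eq0 -mulr2n -mulr_natl mulf_neq0.
have card2 : #|[set y; - y]| = 2%N by rewrite cards2 yNy.
rewrite sum1_card -[RHS]card2; apply: eq_card => x.
rewrite [LHS]unfold_in /= in_set2 inE  eqf_sqr.
apply/andP/idP=> [[]//|xy]; split=> //.
by case/orP: xy => /eqP ->; rewrite ?oppr_eq0.
Qed.

Lemma card_nonsquares : #|B1| = #|B0|.
Proof. by move: card_neq0 card_neq0_double; lia. Qed.

Lemma card_field_squares : #|F| = (#|B0| * 2).+1.
Proof.
rewrite -card_neq0_double (cardD1 0) add1n; congr _.+1.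
by apply: eq_card => x; rewrite !inE andbT.
Qed.

Lemma mul_nz_squares (c x : F) :
  c \in B0 -> (c * x \in B0) = (x \in B0).
Proof.
case/nz_squaresP=> d d0 ->; apply/nz_squaresP/nz_squaresP => -[y y0].
  move=> e; exists (y / d); first by rewrite mulf_neq0 ?invr_eq0.
  by rewrite expr_div_n -e mulrC mulKf ?expf_neq0.
by move=> ->; exists (d * y); rewrite ?mulf_neq0 ?exprMn.
Qed.

(** Multiplication by [c] sends [B0] injectively into [B1]; as the two sets have the same size, the
    image is all of [B1]. *)
Lemma mul_nonsquare (c x : F) :
  c \in B1 -> (c * x \in B1) = (x \in B0).
Proof.
move=> cB1; have c0 := nonsquares_neq0 cB1.
have sub: [set c * y | y in B0] \subset B1.
  apply/subsetP => _ /imsetP[y yB0 ->].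
  rewrite in_nonsquares (mulf_neq0 c0 (nz_squares_neq0 yB0)) mulrC.
  rewrite mul_nz_squares //.
  by move: cB1; rewrite in_nonsquares => /andP[].
have inj : injective ( *%R c) by exact: mulfI.
have /eqP <- : [set c * y | y in B0] == B1.
  by rewrite eqEcard sub card_imset // card_nonsquares leqnn.
by rewrite (mem_imset _ _ inj).
Qed.

(** A pair in [B0] x [B1] with sum [g] is recorded by its first component. *)
Definition representations (g : F) : {set F} :=
  [set x | (x \in B0) && (g - x \in B1)].

Lemma in_representations (x g : F) :
  (x \in representations g) = (x \in B0) && (g - x \in B1).
Proof. exact: in_set. Qed.

Lemma card_representationsM (c g : F) : c != 0 ->
  #|representations (c * g)| = #|representations g|.
Proof.
move=> c0.
have B1E x : x != 0 -> (x \in B1) = (x \notin B0).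
  by rewrite in_nonsquares => ->.
have B00 : 0 \notin B0 by rewrite inE eqxx.
have B10 : 0 \notin B1 by rewrite in_nonsquares eqxx.
have [cB0|cB0] := boolP (c \in B0).
  rewrite -(card_imset (representations g) (mulfI c0)).
  apply: eq_card => x; rewrite -[x](mulVKf c0) mem_imset; last exact: mulfI.
  set y := c^-1 * x; rewrite !in_representations -mulrBr mul_nz_squares //.
  congr (_ && _).
  (* Zero lies in neither class, so it is set apart before [B1] is treated as the complement of
     [B0]. *)
  have [->|z0] := eqVneq (g - y) 0; first by rewrite mulr0 -/B1.
  by rewrite -/B1 !B1E ?mulf_neq0 // mul_nz_squares.
have cB1 : c \in B1 by rewrite B1E.
(* A nonsquare [c] swaps the classes, so the scaled pair must be reversed: its square part is [c]
   times the nonsquare [g - x]. *)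
have inj : injective (fun x => c * (g - x)).
  by move=> x y /(mulfI c0)/addrI/oppr_inj.
rewrite -(card_imset (representations g) inj).
apply: eq_card => x; have xE : x = c * (g - (g - c^-1 * x)).
  by rewrite subKr mulVKf.
rewrite xE (mem_imset _ _ inj) !in_representations; set y := g - c^-1 * x.
rewrite -mulrBr subKr mul_nonsquare // andbC; congr (_ && _).
have [->|z0] := eqVneq (c^-1 * x) 0.
  by rewrite mulr0 (negPf B00) (negPf B10).
have := mul_nonsquare (c^-1 * x) cB1.
by rewrite (B1E _ (mulf_neq0 c0 z0)) (B1E _ z0) => <-; rewrite negbK.
Qed.

(** Grouping the products [e x * e y] by [g = x + y] gives each [e g] a multiplicity that is
    constant off 0. The character is left general to allow both monomial classes and the trivial
    character. *)
Lemma sum_squares_mul (R : comNzRingType) (e : F -> R) :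
    e 0 = 1 -> {morph e : x y / x + y >-> x * y} ->
  (\sum_(x in B0) e x) * (\sum_(y in B1) e y)
  = #|representations 0|%:R + #|representations 1|%:R * \sum_(g | g != 0) e g.
Proof.
move=> e0 eD; rewrite mulr_suml.
transitivity (\sum_g #|representations g|%:R * e g).
  transitivity (\sum_(x in B0) \sum_(g | g - x \in B1) e g).
    apply: eq_bigr => x _; rewrite mulr_sumr.
    rewrite [RHS](reindex_inj (addrI x)) /=.
    by apply: eq_big => y; rewrite ?eD // addrC addKr.
  rewrite (exchange_big_dep predT) //=; apply: eq_bigr => g _.
  rewrite sumr_const -[LHS]mulr_natl; congr (_%:R * _).
  by apply: eq_card => x; rewrite [RHS]in_representations.
rewrite (bigD1 0) //= e0 mulr1 mulr_sumr; congr (_ + _).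
by apply: eq_bigr => g g0; rewrite -{1}[g]mulr1 card_representationsM.
Qed.

Lemma card_representations_total :
  (#|B0| * #|B1|
   = #|representations 0%R| + #|representations 1%R| * (#|B0| * 2))%N.
Proof.
(* The trivial character turns the product formula into a count of pairs. *)
have /eqP := sum_squares_mul (R := int) (e := fun=> 1) erefl (fun _ _ => erefl).
rewrite !sumr_const -(cardsE (fun g : F => g != 0)) card_neq0_double.
by rewrite -!natrM -natrD Num.Theory.eqr_nat => /eqP.
Qed.

Lemma quad_charN1 :
  quad_char (-1 : F) = if -1 \in B0 then 1 else -1.
Proof.
rewrite /quad_char in_nonsquares oppr_eq0 oner_eq0 -/B0 /=.
by case: ifPn => // ->.
Qed.

(** Here the second component is [- x], which for a square [x] is a nonsquare exactly when -1 is. *)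
Lemma card_representations0 :
  #|representations 0| = if -1 \in B0 then 0%N else #|B0|.
Proof.
case: ifPn => m1.
  apply: eq_card0 => x; rewrite [LHS]in_representations sub0r -mulN1r.
  rewrite in_nonsquares mul_nz_squares //.
  by rewrite andbCA andbN andbF.
have m1B1 : -1 \in B1 by rewrite in_nonsquares oppr_eq0 oner_eq0.
apply: eq_card => x; rewrite [LHS]in_representations sub0r -mulN1r.
by rewrite mul_nonsquare // andbb.
Qed.

Lemma card_representations1 :
  4%:R * #|representations 1%R|%:R
  = #|F|%:R - 2%:R + @quad_char F (-1)%R :> int.
Proof.
(* Every term of the total count has a factor [#|B0|] once [N(0)] is known; positivity lets it be
   cancelled. *)
have B0_gt0 : (0 < #|B0|)%N.
  by apply/card_gt0P; exists 1; apply/nz_squaresP; exists 1;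
     rewrite ?oner_eq0 ?expr1n.
move: card_representations_total.
rewrite card_field_squares card_representations0 quad_charN1 card_nonsquares.
by case: ifP => _; nia.
Qed.

(** Since the nonzero classes sum to Phi - 1, the difference [N(0) - N(1)] is the constant term of
    the product. *)
Lemma card_representations0_chi :
  4%:R * (#|representations 0%R|%:R - #|representations 1%R|%:R)
  = 1 - #|F|%:R * @quad_char F (-1)%R :> int.
Proof.
rewrite mulrBr card_representations1 card_representations0 quad_charN1.
by rewrite card_field_squares; case: ifP => _; lia.
Qed.

End SquareCounting.

(** * Powers of the indeterminates in the residue ring *)

Section ResidueMorphism.

Variables p m : nat.

HB.instance Definition _ :=
  GRing.RMorphism.copy (@residue p m)
    (\pi_{ideal_quot (ideal_X_idealr p m)})%qT.

Lemma residue_Xp (k : 'I_m) : residue p 'X_k ^+ p = 1.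
Proof.
apply/eqP; rewrite -rmorphXn -(rmorph1 (@residue p m)).
rewrite -Quotient.idealrBE; apply/boolp.asboolP.
exists (fun i => (i == k)%:R).
rewrite (bigD1 k) //= eqxx mul1r big1 ?addr0 // => i /negPf ->.
by rewrite mul0r.
Qed.

Lemma residue_monomial (e : 'X_{1..m}) :
  residue p 'X_[e] = \prod_(k < m) residue p 'X_k ^+ e k.
Proof.
by rewrite mpolyXE_id rmorph_prod; apply: eq_bigr => k _; rewrite rmorphXn.
Qed.

End ResidueMorphism.

(** A linear relation between the powers is a polynomial of degree below [m] vanishing at [x]; if
    nonzero, it would be coprime to the irreducible [P] and yet share the root [x]. *)
Lemma powers_basis (F : fieldType) (L : fieldExtType F) (P : {poly F})
    (x : L) (m : nat) :
  irreducible_poly P -> size P = m.+1 -> root (map_poly (in_alg L) P) x ->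
  \dim {:L} = m -> basis_of {:L} [tuple x ^+ i | i < m].
Proof.
move=> P_irr size_P Px0 dimL.
rewrite basisEfree subvf size_tuple dimL leqnn !andbT.
apply/freeP => c c0 i.
(* The default 0 is never reached, as [j < m]. *)
pose Q := \poly_(j < m) (if insub j is Some j' then c j' else 0).
have Qx : root (map_poly (in_alg L) Q) x.
  rewrite /root /Q poly_def rmorph_sum horner_sum -[X in _ == X]c0.
  apply/eqP/eq_bigr => j _.
  rewrite /= valK map_polyZ map_polyXn hornerZ hornerXn.
  by rewrite (nth_map j) ?size_enum_ord // nth_ord_enum mulr_algl.
have -> : c i = Q`_i by rewrite coef_poly ltn_ord valK.
suff /eqP -> : Q == 0 by rewrite coef0.
apply: contraTT Qx => Q0.
have cop : coprimep P Q.
  rewrite /coprimep size_poly_eq1.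
  have [//|] := irredp_XsubCP P_irr (dvdp_gcdl P Q).
  rewrite eqp_sym => PQ.
  have {}PQ : P %| Q by rewrite (eqp_dvdl _ PQ) dvdp_gcdr.
  move: (dvdp_leq Q0 PQ); rewrite size_P ltnNge.
  by rewrite size_poly.
move: cop; rewrite -(coprimep_map (in_alg L)) => /coprimep_root.
by move/(_ _ Px0).
Qed.

(** * The additive character given by monomial classes *)

Section CharacterOfMonomials.

Variables (p m : nat) (L : fieldExtType 'F_p) (eta : L).
Hypothesis p_prime : prime p.
Hypothesis eta_basis : basis_of {:L} [tuple eta ^+ i | i < m].

Definition monomial_class (g : finvect_type L) : residue_ring p m :=
  residue p 'X_[monomial_of m eta g].

Lemma monomial_classE g :
  monomial_class g = \prod_(k < m)
    residue p 'X_k ^+ (coord [tuple eta ^+ i | i < m] k (g : L) : 'F_p).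
Proof.
rewrite /monomial_class residue_monomial.
by apply: eq_bigr => k _; rewrite mnmE.
Qed.

Lemma monomial_class0 : monomial_class 0 = 1.
Proof. by rewrite monomial_classE big1 // => k _; rewrite linear0 expr0. Qed.

Lemma monomial_classD : {morph monomial_class : a b / a + b >-> a * b}.
Proof.
move=> a b; rewrite !monomial_classE -big_split; apply: eq_bigr => k _.
(* Representatives add only modulo [p], which is harmless because ['X_k ^+ p] has class 1. *)
rewrite linearD /= [X in (_ %% X)%N]Fp_cast // expr_mod ?exprD //.
exact: residue_Xp.
Qed.

Lemma sum_monomial_class : \sum_g monomial_class g = residue p (Phi_X p m).
Proof.
pose crd (g : finvect_type L) : {ffun 'I_m -> 'F_p} :=
  [ffun k => coord [tuple eta ^+ i | i < m] k (g : L)].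
have crd_bij : bijective crd.
  exists (fun f : {ffun 'I_m -> 'F_p} =>
      \sum_(k < m) f k *: [tuple eta ^+ i | i < m]`_k : L) => [g|f].
    rewrite {2}(coord_basis eta_basis (memvf (g : L))).
    by apply: eq_bigr => k _; rewrite ffunE.
  by apply/ffunP => k; rewrite ffunE coord_sum_free ?(basis_free eta_basis).
rewrite rmorph_prod /=.
transitivity (\prod_(k < m) \sum_(i : 'F_p) residue p 'X_k ^+ i).
  (* Expanding the product yields one term per choice of exponents, that is, per coordinate vector
     of an element of [L]. *)
  rewrite bigA_distr_bigA /= (reindex crd) /=; last exact: onW_bij.
  apply: eq_bigr => g _; rewrite monomial_classE.
  by apply: eq_bigr => k _; rewrite ffunE.
apply: eq_bigr => k _; rewrite rmorph_sum /=.
rewrite -(big_mkord predT (fun i => residue p 'X_k ^+ i)) Fp_cast // big_mkord.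
by apply: eq_bigr => i _; rewrite rmorphXn.
Qed.

End CharacterOfMonomials.

Theorem theorem4 (p m : nat) (L : fieldExtType 'F_p) (P : {poly 'F_p}) (eta : L)
    (p_prime : prime p) (p_odd : odd p) (m_gt0 : (0 < m)%N)
    (card_L : #|finvect_type L| = (p ^ m)%N)
    (P_irr : irreducible_poly P) (size_P : size P = m.+1)
    (P_eta : root (map_poly (in_alg L) P) eta) :
  let f0 : {mpoly int[m]} := char_fun m eta (nz_squares (finvect_type L)) in
  let f1 : {mpoly int[m]} := char_fun m eta (nonsquares (finvect_type L)) in
  let y0 : residue_ring p m := residue p f0 in
  let y1 : residue_ring p m := residue p f1 in
  let sigma1 := y0 + y1 in
  let sigma2 := y0 * y1 in
  let quadratic : {poly residue_ring p m} :=
    'X^2 - sigma1 *: 'X + sigma2%:P in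
  let chi : int := quad_char (-1 : finvect_type L) in
  let q : int := (p ^ m)%N in
  [/\ root quadratic y0,
      root quadratic y1,
      sigma1 = residue p (-1 + Phi_X p m)
    & exists2 S : {mpoly int[m]},
        4%:R * S = - ((q * chi - 1)%:MP - Phi_X p m * (q - 2%:R + chi)%:MP)
        & sigma2 = residue p S].
Proof.
have p_char : p \in [pchar finvect_type L].
  exact: card_finPcharP card_L p_prime.
have two_neq0 : 2%:R != 0 :> finvect_type L.
  rewrite -(dvdn_pcharf p_char); apply: contraL p_odd.
  by rewrite dvdn_prime2 // => /eqP ->.
have dimL : \dim {:L} = m.
  have card_LE : #|finvect_type L| = (#|'F_p| ^ \dim {:L})%N.
    by rewrite -(card_vspace {:finvect_type L}) card_vspacef.
  apply/eqP; rewrite -(eqn_exp2l _ _ (prime_gt1 p_prime)) -card_L card_LE.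
  by rewrite card_Fp.
have basis := powers_basis P_irr size_P P_eta dimL.
move=> f0 f1 y0 y1 sigma1 sigma2 quadratic chi q.
have y0E : y0 = \sum_(g in nz_squares _) monomial_class m eta g.
  exact: rmorph_sum.
have y1E : y1 = \sum_(g in nonsquares _) monomial_class m eta g.
  exact: rmorph_sum.
have sum_neq0 : \sum_(g | g != 0) monomial_class m eta g
    = residue p (-1 + Phi_X p m).
  rewrite rmorphD rmorphN1 /= -(sum_monomial_class p_prime basis).
  rewrite [in RHS](bigD1 0) //=.
  by rewrite monomial_class0 addKr.
split.
- by rewrite /root /quadratic !hornerE /sigma1 /sigma2; apply/eqP; ring.
- by rewrite /root /quadratic !hornerE /sigma1 /sigma2; apply/eqP; ring.
- rewrite -sum_neq0 /sigma1 y0E y1E.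
  rewrite [RHS](bigID (fun g => g \in nz_squares _)) /=; congr (_ + _).
    by apply: eq_bigl => g; rewrite andb_idl // => /nz_squares_neq0.
  by apply: eq_bigl => g; rewrite in_nonsquares.
set n0 := #|representations (0 : finvect_type L)|.
set n1 := #|representations (1 : finvect_type L)|.
(* This lifts the product formula to integer polynomials; 4 times it is [4(n0 - n1) + 4 n1 Phi],
   whose two coefficients are the evaluated counts. *)
exists (n0%:R + n1%:R * (-1 + Phi_X p m)); last first.
  rewrite /sigma2 y0E y1E (sum_squares_mul two_neq0 (monomial_class0 m eta));
    last exact: monomial_classD.
  by rewrite rmorphD rmorphM !rmorph_nat sum_neq0.
have := card_representations1 two_neq0.
have := card_representations0_chi two_neq0.
rewrite card_L natz -/n0 -/n1 -/chi -/q => chi0 chi1.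
rewrite -[q * chi - 1]opprB -chi0 -chi1.
by rewrite mpolyCN !mpolyCM mpolyCB !mpolyC_nat; ring.
Qed.
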